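(* $t(K(9,4))=\frac{5}{4}$. Moreover, if $S$ is a vertex cut of $K(9,4)$ such that $\frac{|S|}{c(K(9,4)\setminus S)} = \frac{5}{4}$, then $S$ is the complement of a maximum independent set of $K(9,4)$.
   Context: The Kneser graph $K(n,k)$ has as vertices the $k$-element subsets of $[n]=\{1,\dots,n\}$, two vertices being adjacent iff they are disjoint. A vertex cut is a set $S$ of vertices whose removal disconnects the graph; $c(G\setminus S)$ is the number of connected components after deleting $S$; the toughness is $t(G)=\min_S |S|/c(G\setminus S)$ over vertex cuts $S$. *)

(* Defs.v *)
From mathcomp Require Import all_boot all_order all_algebra.
Set Implicit Arguments.
Unset Strict Implicit.
Unset Printing Implicit Defensive.
Import Order.TTheory GRing.Theory Num.Theory.

Definition del_rel (V : finType) (adj : rel V) (S : {set V}) : rel V :=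
  [rel x y | [&& x \notin S, y \notin S & adj x y]].

Definition ncomp (V : finType) (adj : rel V) (S : {set V}) : nat :=
  #|[set [set y in ~: S | connect (del_rel adj S) x y] | x in ~: S]|.

Definition vertex_cut (V : finType) (adj : rel V) (S : {set V}) : bool :=
  1 < ncomp adj S.

Definition cut_ratio (V : finType) (adj : rel V) (S : {set V}) : rat :=
  (#|S|%:R / (ncomp adj S)%:R)%R.

Definition is_toughness (V : finType) (adj : rel V) (t : rat) : Prop :=
  (exists S : {set V}, vertex_cut adj S /\ cut_ratio adj S = t) /\
  (forall S : {set V}, vertex_cut adj S -> (t <= cut_ratio adj S)%R).

Definition independent (V : finType) (adj : rel V) (I : {set V}) : bool :=
  [forall x in I, forall y in I, ~~ adj x y].

Definition max_independent (V : finType) (adj : rel V) (I : {set V}) : Prop :=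
  independent adj I /\
  forall J : {set V}, independent adj J -> #|J| <= #|I|.

Definition kneser_vertex (n k : nat) := {A : {set 'I_n} | #|A| == k}.

Definition kneser_adj (n k : nat) : rel (kneser_vertex n k) :=
  fun A B : kneser_vertex n k => [disjoint (val A) & (val B)].

(* Main.v *)
(* Let A be the adjacency matrix of K(9,4), with eigenvalues 5, 3, 1, -2, -4, so
   that A + 4 - J/14 and 3 - A + J/63 are positive semidefinite.  Give every
   vertex of a component of m vertices the weight (4m + 5)/(36m), and the deleted
   vertices weight 0; let T be the total weight.  The second form bounds the
   number of edges inside a component, whence the value of A + 4 on the weights
   is at most T, with equality only if all components are singletons.  The first
   form then gives T^2/14 <= T, that is T <= 14, and 36 T = 504 - 4|S| + 5c. *)
Require Import Defs.
From mathcomp Require Import all_boot all_order all_algebra.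
From mathcomp Require Import zify ring lra.
Set Implicit Arguments.
Unset Strict Implicit.
Unset Printing Implicit Defensive.
Import Order.TTheory GRing.Theory Num.Theory.
Local Open Scope ring_scope.

Local Notation K := (kneser_vertex 9 4).
Local Notation adj := (@kneser_adj 9 4).

(** * Intersection sizes and neighbour counts in K(9,4) *)

Definition isize (X Y : K) : nat := #|val X :&: val Y|.

Lemma isizeC X Y : isize X Y = isize Y X.
Proof. by rewrite /isize setIC. Qed.

Lemma card_vertex (X : K) : #|val X| = 4%N.
Proof. exact/eqP/(valP X). Qed.

Lemma card_vertexC (X : K) : #|~: val X| = 5%N.
Proof. by have := cardsC (val X); rewrite card_vertex card_ord => -[]. Qed.

Lemma isize_le4 X Y : (isize X Y <= 4)%N.
Proof. by rewrite -(card_vertex X) subset_leq_card ?subsetIl. Qed.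

Lemma isize4 X Y : (isize X Y == 4%N) = (X == Y).
Proof.
apply/eqP/eqP => [XY4|->]; last by rewrite /isize setIid card_vertex.
apply: val_inj; apply/eqP; rewrite eqEcard !card_vertex leqnn andbT.
apply/setIidPl/eqP; rewrite eqEcard subsetIl card_vertex.
by rewrite -[#|_|]/(isize X Y) XY4.
Qed.

Lemma adjE X Y : adj X Y = (isize X Y == 0%N).
Proof. by rewrite /kneser_adj -setI_eq0 /isize cards_eq0. Qed.

Lemma adjC X Y : adj X Y = adj Y X.
Proof. by rewrite !adjE isizeC. Qed.

(* The neighbours of X are the sets ~: X :\ u with u outside X. *)
Lemma card_adj_isize X Y l :
  #|[set Z : K | adj X Z && (isize Z Y == l)]|
  = ((isize X Y + l == 4) * (isize X Y).+1
     + (isize X Y + l == 3) * (4 - isize X Y))%N.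
Proof.
set A := [set Z | _].
pose B := [set u in ~: val X | #|(~: val X :\ u) :&: val Y| == l].
have -> : #|A| = #|B|.
  rewrite -(card_imset (mem A) val_inj).
  have inj : {in mem B &, injective (fun u => ~: val X :\ u)}.
    move=> u v /=; rewrite !inE => /andP[uX _] /andP[vX _] /setP/(_ u).
    by rewrite !inE eqxx uX /= andbT; case: eqP.
  rewrite -(card_in_imset inj); apply: eq_card => Z.
  apply/imsetP/imsetP => [[W]|[u]].
    rewrite inE => /andP[XW WY] ->.
    have sWX : val W \subset ~: val X by rewrite subsetC -disjoints_subset.
    have /cards1P [u uE] : #|~: val X :\: val W| == 1%N.
      by rewrite cardsD (setIidPr sWX) card_vertexC card_vertex.
    have WE : val W = ~: val X :\ u.
      by rewrite -uE setDDr setDv set0U (setIidPr sWX).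
    exists u => //; rewrite inE -WE WY andbT.
    by have := set11 u; rewrite -uE inE => /andP[].
  rewrite inE => /andP[uX uY] ->.
  have cW : #|~: val X :\ u| == 4%N.
    by have := cardsD1 u (~: val X); rewrite uX card_vertexC => -[/esym/eqP].
  exists (Sub (~: val X :\ u) cW) => //; rewrite inE /isize /kneser_adj SubK uY.
  by rewrite disjoints_subset subsetC subD1set.
have cYX : #|val Y :\: val X| = (4 - isize X Y)%N.
  by rewrite cardsD card_vertex setIC.
have cYE u : u \in ~: val X ->
    #|(~: val X :\ u) :&: val Y| = (4 - isize X Y - (u \in val Y))%N.
  move=> uX; rewrite -cYX (cardsD1 u (val Y :\: val X)).
  rewrite inE -in_setC uX addKn; apply: eq_card => v.
  by rewrite !inE -andbA.
have -> : B = [set u in ~: val X | (4 - isize X Y - (u \in val Y))%N == l].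
  by apply/setP=> u; rewrite !inE; case uX: (_ \in _) => //=; rewrite cYE ?inE ?uX.
have cXY : #|~: val X :\: val Y| = (isize X Y).+1.
  have := cardsID (val Y) (~: val X); rewrite card_vertexC.
  have -> : ~: val X :&: val Y = val Y :\: val X by rewrite setIC -setDE.
  by rewrite cYX; have := isize_le4 X Y; lia.
(* Put i = [isize X Y]. The 4 - i points u in [val Y] outside [val X] leave an intersection of size
   3 - i, the other i + 1 choices of u leave 4 - i. For i = 4 the truncated 3 - i is harmless, as
   there are no points of the first sort. *)
rewrite -sum1dep_card big_mkcondr (big_setID (val Y)) /=.
rewrite (eq_bigr (fun=> ((3 - isize X Y)%N == l) : nat)); last first.
  by move=> u; rewrite inE => /andP[_ ->]; rewrite -subnDA addnC subnDA; case: eqP.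
rewrite sum_nat_const.
rewrite (eq_bigr (fun=> ((4 - isize X Y)%N == l) : nat)); last first.
  by move=> u; rewrite inE => /andP[/negPf-> _]; rewrite subn0; case: eqP.
rewrite sum_nat_const cXY setIC -setDE cYX.
have := isize_le4 X Y; lia.
Qed.

(** * The relation matrices of the Johnson scheme J(9,4) *)

(** The matrix A_l of the relation |X :&: Y| = l, applied to the vector f. Thus A_0 is the adjacency
    matrix A and A_4 is the identity. *)
Definition shell_sum (R : realFieldType) (l : nat) (f : K -> R) (X : K) : R :=
  \sum_Y (isize X Y == l)%:R * f Y.

Lemma shell_sum4 (R : realFieldType) (f : K -> R) X : shell_sum 4 f X = f X.
Proof.
rewrite /shell_sum (bigD1 X) //= isize4 eqxx mul1r big1 ?addr0 // => Y YX.
by rewrite isize4 eq_sym (negPf YX) mul0r.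
Qed.

Lemma sum_shell_sum (R : realFieldType) (f : K -> R) X : \sum_(l < 5) shell_sum l f X = \sum_Y f Y.
Proof.
rewrite exchange_big /=; apply: eq_bigr => Y _ /=.
have ltXY : (isize X Y < 5)%N by rewrite ltnS isize_le4.
rewrite -mulr_suml (bigD1 (Ordinal ltXY)) //= eqxx big1 ?addr0 ?mul1r // => l.
by rewrite -val_eqE /= eq_sym => /negPf->.
Qed.

(** Each A_l is symmetric because [isize] is. *)
Lemma shell_sum_comm (R : realFieldType) l (f g : K -> R) :
  \sum_X f X * shell_sum l g X = \sum_X shell_sum l f X * g X.
Proof.
under eq_bigr do rewrite /shell_sum mulr_sumr.
rewrite exchange_big /=; apply: eq_bigr => Y _; rewrite /shell_sum mulr_suml.
by apply: eq_bigr => X _; rewrite isizeC; ring.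
Qed.

(** The (X, Y) entry of A A_l counts the neighbours Z of X with |Z :&: Y| = l, which is what
    [card_adj_isize] computes. *)
Lemma shell_sum0_comp (R : realFieldType) l (f : K -> R) X :
  shell_sum 0 (shell_sum l f) X
  = \sum_Y ((isize X Y + l == 4) * (isize X Y).+1
            + (isize X Y + l == 3) * (4 - isize X Y))%:R * f Y.
Proof.
rewrite {1}/shell_sum; under eq_bigr do rewrite /shell_sum mulr_sumr.
rewrite exchange_big /=; apply: eq_bigr => Y _ /=.
rewrite -card_adj_isize -sum1dep_card [in RHS]big_mkcond natr_sum mulr_suml.
apply: eq_bigr => Z _; rewrite mulrA -natrM mulnb -adjE.
by case: ifP.
Qed.

(** Both sides have the form of a sum over Y of a coefficient depending only on [isize X Y] times
    [f Y], so it suffices to compare coefficients. *)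
Ltac shell_comp :=
  rewrite ?shell_sum0_comp /shell_sum ?mulr_sumr -?big_split; apply: eq_bigr => Y _;
  rewrite /= ?mulrA -?mulrDl -?natrM -?natrD; congr (_%:R * _); lia.

Lemma shell_sum00 (R : realFieldType) (f : K -> R) X :
  shell_sum 0 (shell_sum 0 f) X = shell_sum 3 f X + 5 * shell_sum 4 f X.
Proof. shell_comp. Qed.

Lemma shell_sum01 (R : realFieldType) (f : K -> R) X :
  shell_sum 0 (shell_sum 1 f) X = 2 * shell_sum 2 f X + 4 * shell_sum 3 f X.
Proof. shell_comp. Qed.

Lemma shell_sum03 (R : realFieldType) (f : K -> R) X :
  shell_sum 0 (shell_sum 3 f) X = 4 * shell_sum 0 f X + 2 * shell_sum 1 f X.
Proof. shell_comp. Qed.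

Lemma card_adj X : #|[set Z : K | adj X Z]| = 5%N.
Proof.
have XX : isize X X = 4%N by apply/eqP; rewrite isize4.
have := card_adj_isize X X 0; rewrite XX.
move=> cE; rewrite -[RHS]cE; apply: eq_card => Z.
by rewrite !inE adjE isizeC andbb.
Qed.

Lemma card_kneser94 : #|{: K}| = 126%N.
Proof. by rewrite card_sig -cardsE card_draws card_ord. Qed.

Lemma sum_shell_sum0 (R : realFieldType) (f : K -> R) :
  \sum_X shell_sum 0 f X = 5 * \sum_X f X.
Proof.
have := shell_sum_comm 0 (fun=> 1) f; under eq_bigr do rewrite mul1r.
move=> ->; rewrite mulr_sumr; apply: eq_bigr => X _; congr (_ * _).
have -> : 5 = #|[set Z : K | adj X Z]|%:R :> R by rewrite card_adj.
rewrite -sum1dep_card [in RHS]big_mkcond natr_sum.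
by apply: eq_bigr => Z _; rewrite mulr1 -adjE; case: ifP.
Qed.

(** * Two positive semidefinite forms built from A *)

Section Forms.
Variables (R : realFieldType) (f : K -> R).
Let d l := shell_sum l f.
Let q l := \sum_X f X * d l X.
Let T := \sum_X f X.

Lemma sum_sqr_shell0 : \sum_X d 0 X * d 0 X = q 3 + 5 * q 4.
Proof.
rewrite -shell_sum_comm mulr_sumr -big_split; apply: eq_bigr => X _ /=.
by rewrite shell_sum00 /d; ring.
Qed.

Lemma sum_shell03 : \sum_X d 0 X * d 3 X = 4 * q 0 + 2 * q 1.
Proof.
rewrite -shell_sum_comm !mulr_sumr -big_split; apply: eq_bigr => X _ /=.
by rewrite shell_sum03 /d; ring.
Qed.

Lemma sum_shell01 : \sum_X d 0 X * d 1 X = 2 * q 2 + 4 * q 3.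
Proof.
rewrite -shell_sum_comm !mulr_sumr -big_split; apply: eq_bigr => X _ /=.
by rewrite shell_sum01 /d; ring.
Qed.

(** Since A_3 = A^2 - 5, the square of A_3 is A (A A_3) - 5 A_3, so products with A suffice. *)
Lemma sum_sqr_shell3 : \sum_X d 3 X * d 3 X = 20 * q 4 + 7 * q 3 + 4 * q 2.
Proof.
have -> : \sum_X d 3 X * d 3 X =
    \sum_X shell_sum 0 (d 0) X * d 3 X - 5 * q 3.
  rewrite mulr_sumr -sumrB; apply: eq_bigr => X _.
  by rewrite shell_sum00 shell_sum4 /d; ring.
rewrite -shell_sum_comm.
have -> : \sum_X d 0 X * shell_sum 0 (d 3) X =
    4 * (\sum_X d 0 X * d 0 X) + 2 * (\sum_X d 0 X * d 1 X).
  rewrite !mulr_sumr -big_split; apply: eq_bigr => X _ /=.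
  by rewrite shell_sum03 /d; ring.
by rewrite sum_sqr_shell0 sum_shell01; ring.
Qed.

Lemma sum_shell3 : \sum_X d 3 X = 20 * T.
Proof.
have -> : \sum_X d 3 X = \sum_X shell_sum 0 (d 0) X - 5 * T.
  rewrite mulr_sumr -sumrB; apply: eq_bigr => X _.
  by rewrite shell_sum00 shell_sum4 /d; ring.
by rewrite !sum_shell_sum0 -/T; ring.
Qed.

Lemma sqr_sum_shells : T * T = q 0 + q 1 + q 2 + q 3 + q 4.
Proof.
rewrite {1}/T mulr_suml -!big_split; apply: eq_bigr => X _ /=.
by rewrite /T -(sum_shell_sum f X) !big_ord_recr big_ord0 /= /d; ring.
Qed.

(** Squared norm of (a A_3 + b A + c) f plus a constant vector, written linearly in the [q l].
    Choosing e as a multiple of [T] produces a J term; 20, 5 and 1 are the row sums of A_3, A and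
    the identity. *)
Lemma sum_sqr_lin a b c e :
  \sum_X (a * d 3 X + b * d 0 X + c * f X + e) ^+ 2 =
  a ^+ 2 * (20 * q 4 + 7 * q 3 + 4 * q 2) + b ^+ 2 * (q 3 + 5 * q 4)
  + c ^+ 2 * q 4 + 2 * a * b * (4 * q 0 + 2 * q 1) + 2 * a * c * q 3
  + 2 * b * c * q 0 + 2 * e * (20 * a + 5 * b + c) * T + 126 * e ^+ 2.
Proof.
have sum1 : 126 = \sum_(X : K) 1 :> R by rewrite sumr_const card_kneser94.
have -> : 2 * e * (20 * a + 5 * b + c) * T =
    2 * e * a * (20 * T) + 2 * e * b * (5 * T) + 2 * e * c * T by ring.
rewrite -sum_sqr_shell3 -sum_sqr_shell0 -sum_shell03 -sum_shell3 -sum_shell_sum0.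
rewrite sum1 /q /T !mulr_sumr !mulr_suml -!big_split; apply: eq_bigr => X _ /=.
by rewrite /d shell_sum4; ring.
Qed.

(* 70 (A + 4 - J/14) = ((A + 4) (A - 3) - J/7)^2 + 10 (A + 4 - J/14)^2, where
   A^2 = A_3 + 5 for A_3 the matrix of |X :&: Y| = 3. *)
Lemma adj_form_lower : T ^+ 2 / 14 <= q 0 + 4 * q 4.
Proof.
have ge0 (g : K -> R) : 0 <= \sum_X g X ^+ 2 by apply: sumr_ge0 => X _; apply: sqr_ge0.
have := ge0 (fun X => 1 * d 3 X + 1 * d 0 X + (-7) * f X + (- T / 7)).
have := ge0 (fun X => 0 * d 3 X + 1 * d 0 X + 4 * f X + (- T / 14)).
rewrite !sum_sqr_lin; have := sqr_sum_shells; lra.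
Qed.

(* 70 (3 - A + J/63) = ((A + 4) (A - 3) - J/7)^2 + 10 (3 - A + J/63)^2 *)
Lemma adj_form_upper : q 0 <= 3 * q 4 + T ^+ 2 / 63.
Proof.
have ge0 (g : K -> R) : 0 <= \sum_X g X ^+ 2 by apply: sumr_ge0 => X _; apply: sqr_ge0.
have := ge0 (fun X => 1 * d 3 X + 1 * d 0 X + (-7) * f X + (- T / 7)).
have := ge0 (fun X => 0 * d 3 X + (-1) * d 0 X + 3 * f X + (T / 63)).
rewrite !sum_sqr_lin; have := sqr_sum_shells; lra.
Qed.

End Forms.

(** * Edges inside a set of vertices *)

Lemma adjxx X : adj X X = false.
Proof. by rewrite adjE; have /eqP-> : isize X X == 4%N by rewrite isize4. Qed.

(** Three pairwise disjoint 4-sets do not fit into 9 points; in the count, adjacent vertices have no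
    common neighbour. *)
Lemma adj_triangle_free X Y Z : adj X Y -> adj X Z -> adj Y Z = false.
Proof.
move=> XY XZ; apply/negP => YZ; have := card_adj_isize X Y 0.
rewrite adjE in XY; rewrite (eqP XY) => /eqP; rewrite cards_eq0 => /eqP/setP/(_ Z).
by rewrite !inE XZ -adjE adjC YZ.
Qed.

(** Each edge is counted in both directions, so that this is the value of the form of A on the
    indicator of C. *)
Definition arcs (C : {set K}) : nat := \sum_(X in C) #|[set Y in C | adj X Y]|.

Definition indicator (R : realFieldType) (C : {set K}) (X : K) : R := (X \in C)%:R.

Section Indicator.
Variables (R : realFieldType) (C : {set K}).

Lemma sum_indicator : \sum_X indicator R C X = #|C|%:R.
Proof.
rewrite -sum1_card natr_sum [RHS]big_mkcond; apply: eq_bigr => X _.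
by rewrite /indicator; case: ifP.
Qed.

Lemma shell4_indicator :
  \sum_X indicator R C X * shell_sum 4 (indicator R C) X = #|C|%:R.
Proof.
rewrite -sum_indicator; apply: eq_bigr => X _.
by rewrite shell_sum4 -natrM mulnb andbb.
Qed.

Lemma shell0_indicator :
  \sum_X indicator R C X * shell_sum 0 (indicator R C) X = (arcs C)%:R.
Proof.
rewrite natr_sum [RHS]big_mkcond; apply: eq_bigr => X _ /=.
rewrite /indicator; case: ifP => _; last by rewrite mul0r.
rewrite mul1r -sum1dep_card natr_sum [RHS]big_mkcond.
apply: eq_bigr => Y _; rewrite -adjE -natrM mulnb andbC.
by case: ifP.
Qed.

End Indicator.

Lemma arcs_upper (C : {set K}) : (63 * arcs C <= 189 * #|C| + #|C| ^ 2)%N.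
Proof.
have := adj_form_upper (indicator rat C).
rewrite shell0_indicator shell4_indicator sum_indicator => le_arcs.
rewrite -(ler_nat rat) natrD !natrM; lra.
Qed.

Lemma card_nbr_in (C : {set K}) X :
  X \in C -> (#|[set Y in C | adj X Y]| <= #|C|.-1)%N.
Proof.
move=> XC; rewrite (cardsD1 X C) XC /=; apply/subset_leq_card/subsetP => Y.
rewrite !inE => /andP[-> XY]; rewrite andbT; apply/eqP => YX.
by move: XY; rewrite YX adjxx.
Qed.

Lemma arcs_le (C : {set K}) : (arcs C <= #|C| * #|C|.-1)%N.
Proof.
by rewrite -sum_nat_const; apply: leq_sum => X XC; apply: card_nbr_in.
Qed.

(** Either some vertex has at most 2 neighbours in C, and the total is at most 2 + 3 * 3, or C is a
    complete graph, which contains a triangle. The size 4 is singled out because 12 arcs would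
    violate [arcs_weight]. *)
Lemma arcs_card4 (C : {set K}) : #|C| = 4%N -> (arcs C < 12)%N.
Proof.
move=> C4; have [/'exists_andP[X [XC ltX]]|] :=
  boolP [exists X, (X \in C) && (#|[set Y in C | adj X Y]| <= 2)%N].
  have : (\sum_(Y in C :\ X) #|[set Z in C | adj Y Z]| <= #|C :\ X| * 3)%N.
    rewrite -sum_nat_const; apply: leq_sum => Y /setD1P[_ YC].
    by have := card_nbr_in YC; rewrite C4.
  have -> : #|C :\ X| = 3%N by have := cardsD1 X C; rewrite XC C4 => -[].
  move=> le9.
  by rewrite /arcs (big_setD1 X) //= ltnS (leq_add ltX le9).
rewrite negb_exists => /forallP all3.
have nbrE X : X \in C -> [set Y in C | adj X Y] = C :\ X.
  move=> XC; apply/eqP; rewrite eqEcard; apply/andP; split.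
    apply/subsetP => Y; rewrite !inE => /andP[-> XY]; rewrite andbT.
    by apply/eqP => YX; move: XY; rewrite YX adjxx.
  have := all3 X; rewrite XC -ltnNge; have -> //: #|C :\ X| = 3%N.
  by have := cardsD1 X C; rewrite XC C4 => -[].
have /card_gt0P[X XC] : (0 < #|C|)%N by rewrite C4.
have /card_gt0P[Y YCX] : (0 < #|C :\ X|)%N by have := cardsD1 X C; rewrite XC C4; lia.
have /card_gt0P[Z ZCXY] : (0 < #|C :\ X :\ Y|)%N.
  by have := cardsD1 X C; have := cardsD1 Y (C :\ X); rewrite YCX XC C4; lia.
have [YX YC] := setD1P YCX; have [ZY ZCX] := setD1P ZCXY; have [ZX ZC] := setD1P ZCX.
have XY : adj X Y by have := YCX; rewrite -nbrE // inE => /andP[].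
have XZ : adj X Z by have := ZCX; rewrite -nbrE // inE => /andP[].
have : Z \in C :\ Y by apply/setD1P.
by rewrite -nbrE // inE (adj_triangle_free XY XZ) andbF.
Qed.

Lemma arcs_weight (C : {set K}) : (0 < #|C| <= 120)%N ->
  ((4 * #|C| + 5) * (4 * #|C| + arcs C) <= 36 * #|C| ^ 2 ?= iff (#|C| == 1))%N.
Proof.
have := arcs_upper C; have := arcs_le C; have := @arcs_card4 C.
move: #|C| (arcs C) => m a a4 a_le a_up /andP[m_gt0 m_le].
(* For m up to 3 the trivial bound m (m - 1) on arcs is enough, and m = 4 needs [arcs_card4]; from 5
   on the spectral bound [arcs_upper] takes over. *)
have [m5|] := leqP 5 m; last first.
  case: m m_gt0 {m_le a_up} a4 a_le => [|[|[|[|[|]]]]] //= _ a4 a_le _.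
  - by have -> : a = 0%N by lia.
  - by apply/leqifP; rewrite /=; lia.
  - by apply/leqifP; rewrite /=; lia.
  - by have := a4 erefl => {}a4; apply/leqifP; rewrite /=; lia.
have m1 : (m == 1%N) = false by lia.
apply/leqifP; rewrite m1.
(* Inserting [arcs_upper] reduces the claim to (4m + 5)(441 + m) < 2268m, which is this inequality.
   It holds for 5 <= m <= 120 and fails at 4 and at 121. *)
have h1 : (4 * m ^ 2 + 2205 < 499 * m)%N by nia.
have h2 : ((4 * m + 5) * (252 * m + 63 * a) <= (4 * m + 5) * (441 * m + m ^ 2))%N.
  by rewrite leq_mul2l; apply/orP; right; lia.
nia.
Qed.

(** * Components left after deleting a set of vertices *)

Section Components.
Variables (V : finType) (e : rel V) (S : {set V}).
Hypothesis e_sym : symmetric e.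

Definition components : {set {set V}} :=
  equivalence_partition (connect (del_rel e S)) (~: S).

Lemma ncompE : ncomp e S = #|components|.
Proof. by []. Qed.

Lemma connect_del_sym : connect_sym (del_rel e S).
Proof. by apply: sym_connect_sym => x y; rewrite /del_rel /= e_sym andbCA. Qed.

Lemma connect_del_equiv :
  {in ~: S & &, equivalence_rel (connect (del_rel e S))}.
Proof.
move=> x y z _ _ _; split=> [|xy]; first exact: connect0.
by apply/idP/idP; apply: connect_trans; rewrite // connect_del_sym.
Qed.

Lemma components_partition : partition components (~: S).
Proof. exact: equivalence_partitionP connect_del_equiv. Qed.

Lemma component_sub C : C \in components -> C \subset ~: S.
Proof.
move=> CP; have /and3P[/eqP <- _ _] := components_partition.
exact: bigcup_sup CP.
Qed.

(** An edge between surviving vertices is a path of length one, so it cannot leave the component. *)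
Lemma component_adj C x y :
  C \in components -> x \in C -> y \notin S -> e x y -> y \in C.
Proof.
move=> CP xC yS xy; have xS := subsetP (component_sub CP) x xC.
have /and3P[/eqP covP tiP _] := components_partition.
rewrite -(def_pblock tiP CP xC) pblock_equivalence_partition //.
- by apply: connect1; rewrite /del_rel /= yS xy -in_setC xS.
- exact: connect_del_equiv.
- by rewrite inE.
Qed.

Lemma connect_independent x y :
  independent e (~: S) -> connect (del_rel e S) x y = (x == y).
Proof.
move=> indW; apply/idP/eqP => [/connectP[[|z p] /= xp ->] //|->]; last exact: connect0.
have /andP[/and3P[xS zS xz] _] := xp.
have /forall_inP/(_ x) := indW; rewrite inE => /(_ xS) /forall_inP/(_ z).
by rewrite inE xz => /(_ zS).
Qed.

Lemma ncomp_independent : independent e (~: S) -> ncomp e S = #|~: S|.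
Proof.
move=> indW; rewrite /ncomp -(card_imset _ (@set1_inj V)); congr #|pred_of_set _|.
apply: eq_in_imset => x; rewrite inE => xS; apply/setP => y.
rewrite !inE connect_independent // [y == x]eq_sym; apply: andb_idl.
by move=> /eqP <-.
Qed.

Lemma component1_independent : irreflexive e ->
  (forall C, C \in components -> #|C| = 1%N) -> independent e (~: S).
Proof.
move=> irr c1; apply/forall_inP => x xW; apply/forall_inP => y yW; apply/negP => xy.
have /and3P[/eqP covP tiP _] := components_partition.
have xcov : x \in cover components by rewrite covP.
have CP := pblock_mem xcov; have xC : x \in pblock components x by rewrite mem_pblock.
have /eqP/cards1P[z zE] := c1 _ CP; rewrite inE in yW.
have := component_adj CP xC yW xy; move: xC; rewrite zE !inE => /eqP xz /eqP yz.
by rewrite xz yz irr in xy.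
Qed.

End Components.

(** A cut leaves a second component; C avoids any vertex X of it together with the 5 neighbours of
    X, and 126 - 6 = 120. *)
Lemma card_component (S C : {set K}) :
  vertex_cut adj S -> C \in components adj S -> (0 < #|C| <= 120)%N.
Proof.
rewrite /vertex_cut ncompE => cutS CP.
have /and3P[/eqP covP tiP P0] := components_partition S adjC.
have nempty A : A \in components adj S -> (0 < #|A|)%N.
  by move=> AP; rewrite card_gt0; apply: contraNneq P0 => <-.
rewrite nempty //=.
have /card_gt0P[C' /setD1P[C'C C'P]] : (0 < #|components adj S :\ C|)%N.
  by move: cutS; rewrite (cardsD1 C) CP.
have /card_gt0P[X XC'] := nempty _ C'P.
have disj Y : Y \in C -> Y \in C' -> False.
  move=> YC YC'; have := trivIsetP tiP _ _ C'P CP C'C.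
  by move/disjoint_setI0/setP/(_ Y); rewrite !inE YC YC'.
have sub : C \subset ~: (X |: [set Y | adj X Y]).
  apply/subsetP => Y YC; rewrite !inE negb_or; apply/andP; split.
    by apply/eqP => YX; apply: (disj X); rewrite // -YX.
  apply/negP => XY; apply: (disj Y) => //.
  have := subsetP (component_sub adjC CP) Y YC; rewrite inE => YS.
  by have := component_adj adjC C'P XC' YS XY.
apply: leq_trans (subset_leq_card sub) _.
by rewrite cardsCs setCK card_kneser94 cardsU1 inE adjxx card_adj.
Qed.

(* Chosen so that \sum_C #|C| * weight #|C| is linear in the number of
   components and in #|S|; arcs_weight is the resulting local inequality. *)
Definition weight (R : realFieldType) (m : nat) : R := (4 * m%:R + 5) / (36 * m%:R).

(** * The weight vector of a cut and the resulting bound *)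

Section Cut.
Variables (R : realFieldType) (S : {set K}).
Hypothesis cutS : vertex_cut adj S.
Let P := components adj S.

Definition cut_weight (X : K) : R :=
  if X \in S then 0 else weight R #|pblock P X|.

Lemma cut_weightE C X : C \in P -> X \in C -> cut_weight X = weight R #|C|.
Proof.
move=> CP XC; have /and3P[_ tiP _] := components_partition S adjC.
have := subsetP (component_sub adjC CP) X XC; rewrite inE /cut_weight => /negPf->.
by rewrite (def_pblock tiP CP XC).
Qed.

Lemma sum_components (F : K -> R) : (forall X, X \in S -> F X = 0) ->
  \sum_X F X = \sum_(C in P) \sum_(X in C) F X.
Proof.
move=> FS; rewrite -(set_partition_big _ (components_partition S adjC)) /=.
rewrite [RHS]big_mkcond; apply: eq_bigr => X _; rewrite inE.
by case: (boolP (X \in S)) => //= /FS.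
Qed.

Lemma sum_cut_weight : \sum_X cut_weight X = \sum_(C in P) #|C|%:R * weight R #|C|.
Proof.
rewrite sum_components => [|X]; last by rewrite /cut_weight => ->.
apply: eq_bigr => C CP; rewrite (eq_bigr (fun=> weight R #|C|)) => [|X XC].
  by rewrite sumr_const mulr_natl.
exact: cut_weightE.
Qed.

(** A neighbour of X lies in C or in S, and the weight vanishes on S. *)
Lemma shell0_cut_weight C X : C \in P -> X \in C ->
  shell_sum 0 cut_weight X = weight R #|C| * #|[set Y in C | adj X Y]|%:R.
Proof.
move=> CP XC; rewrite -sum1dep_card natr_sum [in RHS]big_mkcond mulr_sumr.
apply: eq_bigr => Y _; rewrite -adjE.
case: (boolP (Y \in C)) => [YC|YC] /=.
  by rewrite (cut_weightE CP YC) mulrC; case: ifP.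
rewrite mulr0; case: (boolP (adj X Y)) => [XY|_]; last by rewrite mul0r.
rewrite mul1r /cut_weight; case: (boolP (Y \in S)) => // YS.
by rewrite (component_adj adjC CP XC YS XY) in YC.
Qed.

Lemma cut_weight_form :
  \sum_X cut_weight X * shell_sum 0 cut_weight X
    + 4 * \sum_X cut_weight X * shell_sum 4 cut_weight X
  = \sum_(C in P) weight R #|C| ^+ 2 * (4 * #|C| + arcs C)%:R.
Proof.
rewrite mulr_sumr -big_split sum_components /= => [|X]; last first.
  by rewrite /cut_weight => ->; rewrite !mul0r mulr0 addr0.
apply: eq_bigr => C CP; rewrite natrD mulrDr addrC natr_sum mulr_sumr.
have -> : weight R #|C| ^+ 2 * (4 * #|C|)%:R = \sum_(X in C) 4 * weight R #|C| ^+ 2.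
  by rewrite sumr_const -[RHS]mulr_natr natrM; ring.
rewrite -big_split; apply: eq_bigr => X XC /=.
by rewrite shell_sum4 (shell0_cut_weight CP XC) (cut_weightE CP XC); ring.
Qed.

Lemma sum_component_card : (\sum_(C in P) #|C| + #|S| = 126)%N.
Proof.
rewrite -(card_partition (components_partition S adjC)) addnC.
by rewrite cardsC card_kneser94.
Qed.

(** A component of m vertices contributes 36 m [weight R m] = 4m + 5, and the components cover 126 -
    |S| vertices. *)
Lemma sum_cut_weightE :
  36 * \sum_X cut_weight X = 504 - 4 * #|S|%:R + 5 * (ncomp adj S)%:R.
Proof.
have tot : (\sum_(C in P) #|C|)%:R + #|S|%:R = 126%:R :> R.
  by rewrite -natrD sum_component_card.
suff sumE : 36 * \sum_X cut_weight X =
    4 * (\sum_(C in P) #|C|)%:R + 5 * (ncomp adj S)%:R.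
  by rewrite sumE; lra.
rewrite ncompE -/P -[#|P|]sum1_card !natr_sum sum_cut_weight.
rewrite !mulr_sumr -big_split /=; apply: eq_bigr => C CP.
have /andP[C_gt0 _] := card_component cutS CP.
by rewrite /weight; field; rewrite pnatr_eq0 -lt0n.
Qed.

(** This is [arcs_weight] multiplied by the positive factor [weight R m / (36 * m%:R)], so the
    equality case carries over. *)
Lemma component_weight_le C : C \in P ->
  weight R #|C| ^+ 2 * (4 * #|C| + arcs C)%:R <= #|C|%:R * weight R #|C|
    ?= iff (#|C| == 1%N).
Proof.
move=> CP; have card_C := card_component cutS CP.
have := arcs_weight card_C; move/andP: card_C => [C_gt0 _].
move: #|C| (arcs C) C_gt0 => m a m_gt0 le_w.
have m0 : (0 : R) < m%:R by rewrite ltr0n.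
have w_gt0 : 0 < weight R m by apply: divr_gt0; lra.
have k_gt0 : 0 < weight R m / (36 * m%:R) by apply: divr_gt0; lra.
have eqL : weight R m ^+ 2 * (4 * m + a)%:R =
    weight R m / (36 * m%:R) * ((4 * m + 5) * (4 * m + a))%:R.
  by rewrite natrM (natrD _ (4 * m)) (natrM _ 4) /weight; field; rewrite lt0r_neq0.
have eqR : m%:R * weight R m = weight R m / (36 * m%:R) * (36 * m ^ 2)%:R.
  by rewrite (natrM _ 36) (natrX _ m) /weight; field; rewrite lt0r_neq0.
rewrite eqL eqR; split; first by rewrite ler_pM2l // ler_nat le_w.
rewrite (inj_eq (mulfI (lt0r_neq0 k_gt0))) eqr_nat; exact: le_w.2.
Qed.

Lemma cut_weight_form_le :
  \sum_(C in P) weight R #|C| ^+ 2 * (4 * #|C| + arcs C)%:R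
    <= \sum_X cut_weight X ?= iff [forall (C | C \in P), #|C| == 1%N].
Proof. by rewrite sum_cut_weight; apply: leif_sum => C; apply: component_weight_le. Qed.

Lemma sum_cut_weight_le : \sum_X cut_weight X <= 14.
Proof.
have := adj_form_lower cut_weight; rewrite cut_weight_form => lower.
have := le_trans lower cut_weight_form_le.1.
move: (\sum_X _) => T le_T; rewrite leNgt; apply/negP => T14.
have : 14 * T < T ^+ 2 by rewrite expr2 ltr_pM2r //; lra.
lra.
Qed.

Lemma cut_bound : (5 * ncomp adj S <= 4 * #|S|)%N.
Proof.
rewrite -(ler_nat R) (natrM _ 5) (natrM _ 4).
have := sum_cut_weightE; have := sum_cut_weight_le; lra.
Qed.

(** Equality forces T = 14, where the lower bound T^2/14 and the upper bound T of the form coincide;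
    the equality case of [cut_weight_form_le] then applies. *)
Lemma cut_bound_eq C :
  (5 * ncomp adj S)%N = (4 * #|S|)%N -> C \in P -> #|C| = 1%N.
Proof.
move=> eq_cs CP; have T14 : \sum_X cut_weight X = 14.
  have : 5 * (ncomp adj S)%:R = 4 * #|S|%:R :> R by rewrite -!natrM eq_cs.
  have := sum_cut_weightE; lra.
have := adj_form_lower cut_weight; rewrite cut_weight_form T14 => lower.
have [le_T] := cut_weight_form_le; rewrite T14 in le_T *.
have -> : \sum_(C in P) weight R #|C| ^+ 2 * (4 * #|C| + arcs C)%:R = 14 by lra.
by rewrite eqxx => /esym/forall_inP/(_ C CP)/eqP.
Qed.

End Cut.

(** * Maximum independent sets *)

(** Hoffman's ratio bound: on the indicator of J the form of A vanishes, so |J|^2/14 <= 4|J|. *)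
Lemma card_independent (J : {set K}) : independent adj J -> (#|J| <= 56)%N.
Proof.
move=> indJ; have arcs0 : arcs J = 0%N.
  apply: big1 => X XJ; apply/eqP; rewrite cards_eq0; apply/eqP/setP => Y.
  rewrite !inE; apply/negP => /andP[YJ XY].
  by have /forall_inP/(_ X XJ)/forall_inP/(_ Y YJ) := indJ; rewrite XY.
have := adj_form_lower (indicator rat J).
rewrite shell0_indicator shell4_indicator sum_indicator arcs0 => lower.
rewrite leqNgt; apply/negP => J56.
have {}J56 : 57%:R <= #|J|%:R :> rat by rewrite ler_nat.
have : 57 * #|J|%:R <= #|J|%:R ^+ 2 :> rat by rewrite expr2 ler_wpM2r.
clear arcs0; lra.
Qed.

(** The extremal Erdos-Ko-Rado family, which attains the bound 56. *)
Definition star : {set K} := [set X : K | ord0 \in val X].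

Lemma star_independent : independent adj star.
Proof.
apply/forall_inP => X; rewrite inE => X0; apply/forall_inP => Y; rewrite inE => Y0.
rewrite /kneser_adj; apply/negP => /disjoint_setI0/setP/(_ ord0).
by rewrite !inE X0 Y0.
Qed.

Lemma card_starC : #|~: star| = 70%N.
Proof.
rewrite -(card_imset _ val_inj).
have -> : 70%N = 'C(#|[set~ ord0 : 'I_9]|, 4) by rewrite cardsC1 card_ord.
rewrite -cards_draws; apply: eq_card => A; rewrite !inE.
apply/imsetP/andP => [[X]|[A0 A4]].
  rewrite !inE => X0 ->; rewrite card_vertex; split => //.
  by rewrite subsetC sub1set inE.
exists (Sub A A4); rewrite ?SubK // !inE SubK.
by move: A0; rewrite subsetC sub1set inE.
Qed.

Lemma card_star : #|star| = 56%N.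
Proof. by rewrite cardsCs card_starC card_kneser94. Qed.

(** * The toughness and the extremal cuts *)

Lemma cut_ratio_le (V : finType) (e : rel V) (S : {set V}) (a b : nat) :
  (0 < b)%N -> vertex_cut e S ->
  (a%:R / b%:R <= cut_ratio e S) = (a * ncomp e S <= b * #|S|)%N.
Proof.
move=> b_gt0 /ltnW c_gt0; rewrite /cut_ratio ler_pdivrMr ?ltr0n // mulrAC.
by rewrite ler_pdivlMr ?ltr0n // -!natrM ler_nat [(#|S| * b)%N]mulnC.
Qed.

Lemma cut_ratio_eq (V : finType) (e : rel V) (S : {set V}) (a b : nat) :
  (0 < b)%N -> vertex_cut e S ->
  (cut_ratio e S == a%:R / b%:R) = (b * #|S| == a * ncomp e S)%N.
Proof.
move=> b_gt0 /ltnW c_gt0; rewrite /cut_ratio eqr_div ?pnatr_eq0 -?lt0n //.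
by rewrite -!natrM eqr_nat mulnC.
Qed.

Lemma ncomp_starC : ncomp adj (~: star) = 56%N.
Proof. by rewrite ncomp_independent setCK ?star_independent // card_star. Qed.

Theorem theorem5p5 :
  is_toughness (@kneser_adj 9 4) (5%:R / 4%:R)%R /\
  (forall S : {set kneser_vertex 9 4},
     vertex_cut (@kneser_adj 9 4) S ->
     cut_ratio (@kneser_adj 9 4) S = (5%:R / 4%:R)%R ->
     exists I : {set kneser_vertex 9 4},
       max_independent (@kneser_adj 9 4) I /\ S = ~: I).
Proof.
have star_cut : vertex_cut adj (~: star) by rewrite /vertex_cut ncomp_starC.
split; [split|].
(* Deleting the 70 vertices outside the star leaves 56 isolated ones, and 70/56 = 5/4. *)
- exists (~: star); split=> //; apply/eqP.
  by rewrite cut_ratio_eq // ncomp_starC card_starC.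
- by move=> S cutS; rewrite cut_ratio_le //; apply: cut_bound rat _ cutS.
move=> S cutS /eqP; rewrite cut_ratio_eq // => /eqP eq_cs.
have indW : independent adj (~: S).
  apply: component1_independent adjC adjxx _ => C.
  exact: (cut_bound_eq rat cutS (esym eq_cs)).
exists (~: S); split; last by rewrite setCK.
split=> // J indJ; apply: leq_trans (card_independent indJ) _.
(* Every remaining vertex is its own component, so 4|S| = 5|~: S|; with |S| + |~: S| = 126 this
   gives |~: S| = 56, the largest possible size. *)
rewrite (ncomp_independent indW) in eq_cs.
have := cardsC S; rewrite card_kneser94.
move: #|S| #|~: S| eq_cs => s w; lia.
Qed.
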